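(* Let $\alpha<\gamma$ be probability levels, and consider the bilinear problem $$\nu^*=\min_{x,T(x),s,\theta,w'}\ \frac1{\gamma-\alpha}\Big((1-\alpha)s+\sum_{i=1}^n\theta_i-\sum_{i=1}^nT_i(x)p_iw'_i\Big)$$ subject to $\theta_i+sp_i\ge p_iT_i(x)$ and $\theta_i\ge0$ for all $i\in[n]$, $w'\in[0,1]^n$ with $\sum_{i=1}^nw'_ip_i=1-\gamma$, and $(x,T(x))\in\mathcal X_T$. Solving this problem when $w'_i=0$ for all $i\in[n]$ (so that the constraint on $w'$ forces $\gamma=1$) is equivalent to solving $$\min_{x,T(x)}\{\mathrm{CVaR}_\alpha\mathbb T(x): (x,T(x))\in\mathcal X_T\},$$ i.e. the two problems have the same optimal value.
   Context: $[n]=\{1,\dots,n\}$. Let $\mathcal X\subseteq\mathbb R^k$ be nonempty and let $Y$ be a discrete random vector in $\mathbb R^m$ having $n$ distinct realizations (atoms) $y_1,\dots,y_n$ with probabilities $p_1,\dots,p_n$ ($p_i>0$, $\sum_ip_i=1$). Let $f:\mathcal X\times\mathbb R^m\to\mathbb R$ be such that for each fixed realization $y$ of $Y$, $f(x,y)$ is linear in $x$. For $x\in\mathcal X$ put $\mathbb T(x)=f(x,Y)$, $T_i(x)=f(x,y_i)$, $T(x)=(T_1(x),\dots,T_n(x))$; $\mathbb T(x)$ takes the values $T_i(x)$ with associated probabilities $p_i$. Probability levels are numbers in $[0,1]$. The constraints $x\in\mathcal X$ and $T_i(x)=f(x,y_i)$, $i\in[n]$, are represented as $Ax+BT(x)\le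 c$ with $A\in\mathbb R^{l\times k}$, $B\in\mathbb R^{l\times n}$, $c\in\mathbb R^l$, and $\mathcal X_T=\{(x,T(x)):Ax+BT(x)\le c\}$ is assumed nonempty, closed and convex. $\mathrm{CVaR}_\alpha\mathbb T(x)=\min_{\eta\in\mathbb R}\big\{\eta+\frac1{1-\alpha}\sum_{i=1}^np_i[T_i(x)-\eta]^+\big\}$ where $[t]^+=\max\{0,t\}$. Here $\min$ of an optimization problem denotes its optimal value. *)

(* Defs.v *)
(* MathComp-Analysis development over an abstract [R : realType].  Vectors are
   column vectors, and the index set [n] = {1,...,n} is ['I_n]. *)
From HB Require Import structures.
From mathcomp Require Import all_boot all_order all_algebra.
From mathcomp Require Import all_classical all_reals all_analysis.
Set Implicit Arguments.
Unset Strict Implicit.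
Unset Printing Implicit Defensive.
Import Order.TTheory GRing.Theory Num.Theory.
Import numFieldNormedType.Exports.
Local Open Scope classical_set_scope.
Local Open Scope ring_scope.

(* Measurability for the Borel sigma-algebra of R^m is stated coordinatewise.
   Since the p_i sum to 1, Y takes no other value with positive probability. *)
Definition discrete_random_vector (R : realType) (d : measure_display)
    (Omega : measurableType d) (P : probability Omega R) (m n : nat)
    (Y : Omega -> 'cV[R]_m) (y : 'I_n -> 'cV[R]_m) (p : 'I_n -> R) : Prop :=
  [/\ forall j : 'I_m, measurable_fun setT (fun w => Y w j ord0),
      injective y,
      forall i, 0 < p i,
      \sum_i p i = 1 &
      forall i, P (Y @^-1` [set y i]) = (p i)%:E].

(* Only the values of [g] on [X] matter. *)
Definition linear_on (R : realType) (k : nat) (X : set 'cV[R]_k)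
    (g : 'cV[R]_k -> R) : Prop :=
  exists L : {linear 'cV[R]_k -> R^o}, forall x, X x -> g x = L x.

(* The vector T(x) of the values T_i(x) = f(x, y_i). *)
Definition scenario (R : realType) (k m n : nat)
    (f : 'cV[R]_k -> 'cV[R]_m -> R) (y : 'I_n -> 'cV[R]_m)
    (x : 'cV[R]_k) : 'cV[R]_n :=
  \col_i f x (y i).

(* The set X_T of the pairs (x, t) with A x + B t <= c, componentwise. *)
Definition polyhedron (R : realType) (k n l : nat)
    (A : 'M[R]_(l, k)) (B : 'M[R]_(l, n)) (c : 'cV[R]_l)
    : set ('cV[R]_k * 'cV[R]_n) :=
  [set z | forall i : 'I_l, (A *m z.1 + B *m z.2) i ord0 <= c i ord0].

(* A x + B t <= c says exactly that x is in X and that t_i = f(x, y_i). *)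
Definition represents (R : realType) (k m n l : nat) (X : set 'cV[R]_k)
    (f : 'cV[R]_k -> 'cV[R]_m -> R) (y : 'I_n -> 'cV[R]_m)
    (A : 'M[R]_(l, k)) (B : 'M[R]_(l, n)) (c : 'cV[R]_l) : Prop :=
  forall (x : 'cV[R]_k) (t : 'cV[R]_n),
    polyhedron A B c (x, t) <-> X x /\ t = scenario f y x.

(* Optimal value of a minimization problem, in the extended reals: +oo if the
   problem is infeasible, -oo if it is unbounded below. *)
Definition optval (R : realType) (V : Type) (F : set V) (g : V -> \bar R)
    : \bar R :=
  ereal_inf [set g v | v in F].

(* CVaR at level alpha of the random variable with values t_i and associated
   probabilities p_i.  For alpha = 1, where the defining formula divides by 0,
   the value is meaningless. *)
Definition CVaR (R : realType) (n : nat) (p : 'I_n -> R) (alpha : R)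
    (t : 'cV[R]_n) : \bar R :=
  optval [set: R] (fun eta =>
    (eta + (1 - alpha)^-1
             * \sum_i p i * Num.max 0 (t i ord0 - eta))%:E).

Record bilinear_vars (R : realType) (k n : nat) := BilinearVars {
  bl_x : 'cV[R]_k;
  bl_T : 'cV[R]_n;
  bl_s : R;
  bl_theta : 'cV[R]_n;
  bl_w : 'cV[R]_n }.

Definition bilinear_feasible (R : realType) (k n : nat) (p : 'I_n -> R)
    (gamma : R) (XT : set ('cV[R]_k * 'cV[R]_n)) : set (bilinear_vars R k n) :=
  [set v |
    [/\ forall i, p i * bl_T v i ord0 <= bl_theta v i ord0 + bl_s v * p i,
        forall i, 0 <= bl_theta v i ord0,
        forall i, 0 <= bl_w v i ord0 <= 1,
        \sum_i bl_w v i ord0 * p i = 1 - gamma &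
        XT (bl_x v, bl_T v)]].

Definition bilinear_objective (R : realType) (k n : nat) (p : 'I_n -> R)
    (alpha gamma : R) (v : bilinear_vars R k n) : R :=
  (gamma - alpha)^-1
    * ((1 - alpha) * bl_s v + \sum_i bl_theta v i ord0
       - \sum_i bl_T v i ord0 * p i * bl_w v i ord0).

(* Main.v *)
Require Import Defs.
From HB Require Import structures.
From mathcomp Require Import all_boot all_order all_algebra.
From mathcomp Require Import all_classical all_reals all_analysis.
Set Implicit Arguments.
Unset Strict Implicit.
Unset Printing Implicit Defensive.
Import Order.TTheory GRing.Theory Num.Theory.
Import numFieldNormedType.Exports.
Local Open Scope classical_set_scope.
Local Open Scope ring_scope.

(** For a fixed scenario vector [t] and a fixed level variable [s], the
    constraints on [theta] say that [theta_i] dominates both [0] and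
    [p_i (t_i - s)], that is, the excess [p_i * max 0 (t_i - s)].  When [w = 0]
    and [gamma = 1] the bilinear term vanishes and the objective is
    [s + (1 - alpha)^-1 * \sum_i theta_i], so the optimal [theta] equals the
    excess and the objective becomes the function of [eta = s] whose infimum
    defines the CVaR (the classical linearization of Rockafellar and Uryasev).
    The bilinear problem is thus the joint minimization over the feasible pair
    and [eta], the other one the same minimization with [eta] optimized first.

    Optimal values are infima that need not be attained, so each inequality
    compares the problems point by point: [CVaR_le_objective] bounds the CVaR
    by the objective at any feasible point, and [feasible_excess] with
    [objective_excess] realizes any [eta] by a feasible point. *)

Lemma optval_le (R : realType) (V : Type) (F : set V) (g : V -> \bar R) v :
  F v -> (optval F g <= g v)%E.
Proof. by move=> Fv; apply: ereal_inf_lbound; exists v. Qed.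

Lemma le_optval (R : realType) (V : Type) (F : set V) (g : V -> \bar R) a :
  (forall v, F v -> (a <= g v)%E) -> (a <= optval F g)%E.
Proof. by move=> ag; apply: le_ereal_inf_tmp => _ [v Fv <-]; exact: ag. Qed.

(** Multiplying by [q >= 0] commutes with the maximum, which turns the two
    linear constraints on [b] into one bound on the positive part. *)
Lemma excess_le (R : realType) (q t s b : R) :
  0 <= q -> 0 <= b -> q * t <= b + s * q -> q * Num.max 0 (t - s) <= b.
Proof.
move=> q0 b0 qtb; rewrite maxr_pMr// mulr0 ge_max b0/=.
by rewrite mulrBr lerBlDr (mulrC q s).
Qed.

Lemma objective_w0 (R : realType) (k n : nat) (p : 'I_n -> R) (alpha : R)
    (v : bilinear_vars R k n) :
  alpha < 1 -> (forall i, bl_w v i ord0 = 0) ->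
  bilinear_objective p alpha 1 v
  = bl_s v + (1 - alpha)^-1 * \sum_i bl_theta v i ord0.
Proof.
move=> alpha1 w0; rewrite /bilinear_objective.
rewrite [X in _ + _ - X]big1 => [|i _]; last by rewrite w0 mulr0.
by rewrite subr0 mulrDr mulKf// subr_eq0 gt_eqF.
Qed.

(** Taking [eta = bl_s v] in the CVaR gives a value at most the objective,
    since each [theta_i] is at least the corresponding excess. *)
Lemma CVaR_le_objective (R : realType) (k n : nat) (p : 'I_n -> R)
    (alpha : R) (XT : set ('cV[R]_k * 'cV[R]_n))
    (v : bilinear_vars R k n) :
  (forall i, 0 <= p i) -> alpha < 1 ->
  bilinear_feasible p 1 XT v -> (forall i, bl_w v i ord0 = 0) ->
  (CVaR p alpha (bl_T v) <= (bilinear_objective p alpha 1 v)%:E)%E.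
Proof.
move=> p0 alpha1 [pTle theta0 _ _ _] w0.
apply: (le_trans (optval_le _ (v := bl_s v) I)).
rewrite objective_w0// lee_fin lerD2l ler_wpM2l//.
  by rewrite invr_ge0 subr_ge0 ltW.
by apply: ler_sum => i _; exact: excess_le.
Qed.

(** The cheapest feasible [theta] at level [eta] is the excess itself. *)
Definition excess_vars (R : realType) (k n : nat) (p : 'I_n -> R)
    (z : 'cV[R]_k * 'cV[R]_n) (eta : R) : bilinear_vars R k n :=
  BilinearVars z.1 z.2 eta
    (\col_i (p i * Num.max 0 (z.2 i ord0 - eta))) 0.

Lemma feasible_excess (R : realType) (k n : nat) (p : 'I_n -> R)
    (XT : set ('cV[R]_k * 'cV[R]_n)) z eta :
  (forall i, 0 <= p i) -> XT z ->
  bilinear_feasible p 1 XT (excess_vars p z eta).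
Proof.
case: z => x t p0 XTz; split => //= [i|i|i|].
- by rewrite mxE (mulrC eta) -mulrDr ler_wpM2l// -lerBlDr le_max lexx orbT.
- by rewrite mxE mulr_ge0// le_max lexx.
- by rewrite mxE lexx ler01.
- by rewrite subrr big1// => i _; rewrite mxE mul0r.
Qed.

Lemma objective_excess (R : realType) (k n : nat) (p : 'I_n -> R)
    (alpha : R) (z : 'cV[R]_k * 'cV[R]_n) eta :
  alpha < 1 ->
  bilinear_objective p alpha 1 (excess_vars p z eta)
  = eta + (1 - alpha)^-1 * \sum_i p i * Num.max 0 (z.2 i ord0 - eta).
Proof.
move=> alpha1; rewrite objective_w0// => [|i]; last by rewrite mxE.
by congr (_ + _ * _); apply: eq_bigr => i _; rewrite mxE.
Qed.

Theorem proposition3 (R : realType) (k m n l : nat)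
    (d : measure_display) (Omega : measurableType d) (P : probability Omega R)
    (Y : Omega -> 'cV[R]_m) (y : 'I_n -> 'cV[R]_m) (p : 'I_n -> R)
    (hY : discrete_random_vector P Y y p)
    (X : set 'cV[R]_k) (hX : X !=set0)
    (f : 'cV[R]_k -> 'cV[R]_m -> R)
    (hf : forall i, linear_on X (fun x => f x (y i)))
    (A : 'M[R]_(l, k)) (B : 'M[R]_(l, n)) (c : 'cV[R]_l)
    (hrep : represents X f y A B c)
    (hXT0 : polyhedron A B c !=set0)
    (hXTclosed : closed (polyhedron A B c))
    (hXTconvex : convex_set (polyhedron A B c))
    (alpha gamma : R) (halpha : 0 <= alpha <= 1) (hgamma : 0 <= gamma <= 1)
    (hlt : alpha < gamma) :
  let feasible_w0 :=
    bilinear_feasible p gamma (polyhedron A B c)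
      `&` [set v | forall i, bl_w v i ord0 = 0] in
  (feasible_w0 !=set0 -> gamma = 1) /\
  (gamma = 1 ->
    optval feasible_w0 (fun v => (bilinear_objective p alpha gamma v)%:E)
    = optval (polyhedron A B c) (fun z => CVaR p alpha (scenario f y z.1))).
Proof.
case: hY => _ _ p_gt0 _ _; have p0 i : 0 <= p i by exact: ltW.
split=> [[v [[_ _ _ sumw _] w0]]|gamma1].
  apply/esym/subr0_eq; rewrite -sumw big1// => i _.
  by rewrite w0 mul0r.
subst gamma; apply/eqP; rewrite eq_le; apply/andP; split.
- apply: le_optval => -[x t] XTz; have [_ tE] := (hrep x t).1 XTz.
  apply: le_optval => eta _; rewrite /= -tE.
  rewrite -(objective_excess p (x, t) eta hlt); apply: optval_le.
  by split; [exact: feasible_excess | move=> i; rewrite mxE].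
- apply: le_optval => v [feas w0]; have [_ _ _ _ XTv] := feas.
  apply: (le_trans (optval_le _ XTv)) => /=.
  have [_ <-] := (hrep _ _).1 XTv.
  exact: (CVaR_le_objective p0 hlt feas).
Qed.
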